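(* Let $w\in S_n$ and let $ccode(w)=(c_1,\dots,c_n)$ be its column-Lehmer code. Then the lexicographically minimal monomial in the Schubert polynomial $\mathfrak{S}_w$ is $$\prod_{i=1}^n x_i^{\#\{j\,\mid\, c_j\ge i\}},$$ and it has coefficient $1$.
   Context: For $w=w_1\cdots w_n\in S_n$, $\mathrm{Inv}(w)=\{(i,j): i<j,\ w_j<w_i\}$ and $l(w)=\#\mathrm{Inv}(w)$. The column-Lehmer code of $w$ is $ccode(w)=(c_1,\dots,c_n)$ with $c_i=\#\{j<i: (j,i)\in\mathrm{Inv}(w)\}$. Schubert polynomials: let $\partial_i(f)=\frac{f-s_i(f)}{x_i-x_{i+1}}$, where $s_i(f)$ is obtained from $f$ by swapping $x_i\leftrightarrow x_{i+1}$. The $\mathfrak{S}_w$, $w\in S_n$, are uniquely determined by $\mathfrak{S}_{w_0}=x_1^{n-1}x_2^{n-2}\cdots x_{n-1}$, where $w_0=n(n-1)\cdots 21$, and $\partial_i\mathfrak{S}_w=\mathfrak{S}_{ws_i}$ if $l(ws_i)<l(w)$ and $\partial_i\mathfrak{S}_w=0$ otherwise, where $ws_i$ is obtained from $w$ by swapping the entries in positions $i$ and $i+1$. Lexicographic order on monomials is taken with $x_1<x_2<\cdots<x_n$: $x^\alpha<x^\beta$ if $\alpha\neq\beta$ and $\alpha_i<\beta_i$ at the largest index $i$ with $\alpha_i\ne\beta_i$. ''Monomial in $\mathfrak{S}_w$'' means a monomial occurring with nonzero coefficient. *)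

(* Defs.v *)
From mathcomp Require Import all_boot all_order all_algebra all_fingroup.
From mathcomp Require Import mpoly ring zify.

Set Implicit Arguments.
Unset Strict Implicit.
Unset Printing Implicit Defensive.

Import GRing.Theory.
Local Open Scope ring_scope.

(* The indices 1..n of the mathematics are the ordinals 0..n-1 of 'I_n, both
   for positions and values of a permutation and for the variables. *)

Definition inversions n (w : 'S_n) : {set 'I_n * 'I_n} :=
  [set p : 'I_n * 'I_n | (p.1 < p.2)%N && (w p.2 < w p.1)%N].

Definition perm_length n (w : 'S_n) : nat := #|inversions w|.

Definition ccode n (w : 'S_n) (i : 'I_n) : nat :=
  #|[set j : 'I_n | (j < i)%N && ((j, i) \in inversions w)]|.

Definition longest_perm n : 'S_n := perm (@rev_ord_inj n).

(* (s * t) x = t (s x) for permutations, so that the word of tperm i j * w is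
   w with its entries in positions i and j exchanged. *)
Definition swap_positions n (i j : 'I_n) (w : 'S_n) : 'S_n := (tperm i j * w)%g.

Lemma swap_positionsE n (i j : 'I_n) (w : 'S_n) k :
  swap_positions i j w k = w (tperm i j k).
Proof. exact: permM. Qed.

(* Lexicographic order for x_1 < ... < x_n: the largest index at which the
   exponents differ decides. *)
Definition mlex_lt n (a b : 'X_{1..n}) : bool :=
  [exists i : 'I_n, (a i < b i)%N && [forall j : 'I_n, (i < j)%N ==> (a j == b j)]].

Definition lex_min_monomial n (m : 'X_{1..n}) (p : {mpoly int[n]}) : Prop :=
  m \in msupp p /\ forall m', m' \in msupp p -> m' != m -> mlex_lt m m'.

Lemma braid_aux (P : idomainType) (s t : {rmorphism P -> P}) (a b f g h u : P) :
  a != 0 -> s a = - a -> s b = a + b -> t a = a + b -> involutive s ->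
  a * g = f - s f -> b * h = g - t g -> a * u = h - s h ->
  a * b * (a + b) * u =
    f - s f - t f + t (s f) + s (t f) - s (t (s f)).
Proof.
move=> a0 sa sb ta ss Eg Eh Eu; apply: (mulfI a0).
have tg : (a + b) * t g = t f - t (s f).
  by rewrite -ta -rmorphM Eg rmorphB.
have abh : a * (a + b) * (b * h) =
    (a + b) * (f - s f) - a * (t f - t (s f)).
  rewrite Eh -Eg -tg; ring.
have := congr1 s abh.
rewrite ?(rmorphM, rmorphB, rmorphD) sa sb !ss => sabh.
transitivity (a * (a + b) * (b * (a * u))); first by ring.
rewrite Eu mulrBr mulrBr abh.
transitivity ((a + b) * (f - s f) - a * (t f - t (s f)) +
  (- a * (- a + (a + b)) * ((a + b) * s h))); first by ring.
rewrite sabh; ring.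
Qed.

Lemma subr_swap (V : zmodType) (x y z t : V) :
  x - y - (z - t) = x - z - (y - t).
Proof. by rewrite !opprB addrACA [RHS]addrACA (addrC (- z)). Qed.

Lemma braid_quotient (P : idomainType) (s t : {rmorphism P -> P})
    (a b f g h u g' h' u' : P) :
  a != 0 -> b != 0 -> a + b != 0 ->
  s a = - a -> t b = - b -> s b = a + b -> t a = a + b ->
  involutive s -> involutive t -> s (t (s f)) = t (s (t f)) ->
  a * g = f - s f -> b * h = g - t g -> a * u = h - s h ->
  b * g' = f - t f -> a * h' = g' - s g' -> b * u' = h' - t h' ->
  u = u'.
Proof.
move=> a0 b0 c0 sa tb sb ta ss tt brd Eg Eh Eu Eg' Eh' Eu'.
have L := braid_aux a0 sa sb ta ss Eg Eh Eu.
rewrite addrC in sb ta c0.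
have R := braid_aux b0 tb ta sb tt Eg' Eh' Eu'.
apply: (mulfI (mulf_neq0 (mulf_neq0 b0 a0) c0)); rewrite R.
by rewrite (mulrC b) (addrC b) L brd; ring.
Qed.

Section DividedDifference.

Variable n : nat.
Implicit Types (i j k l : 'I_n) (f g : {mpoly int[n]}).

Lemma msymXi (s : 'S_n) i : msym s 'X_i = 'X_(s i) :> {mpoly int[n]}.
Proof.
rewrite msymX; congr mpolyX; apply/mnmP=> a; rewrite mnmE !mnm1E.
by rewrite -{2}(permKV s a) (inj_eq perm_inj).
Qed.

Lemma ddiff_exists i j f :
  exists g, f - msym (tperm i j) f == ('X_i - 'X_j) * g.
Proof.
set s := tperm i j.
have hX a : exists g : {mpoly int[n]}, 'X_a - msym s 'X_a = ('X_i - 'X_j) * g.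
  rewrite msymXi /s; case: tpermP => [->|->|_ _].
  - by exists 1; rewrite mulr1.
  - by exists (-1); rewrite mulrN1 opprB.
  - by exists 0; rewrite mulr0 subrr.
have hM p q : (exists g, p - msym s p = ('X_i - 'X_j) * g) ->
    (exists g, q - msym s q = ('X_i - 'X_j) * g) ->
    exists g, p * q - msym s (p * q) = ('X_i - 'X_j) * g.
  move=> [g hg] [h hh]; exists (g * q + msym s p * h).
  by rewrite mulrDr mulrA -hg mulrCA -hh msymM; ring.
suff [g ->]: exists g, f - msym s f = ('X_i - 'X_j) * g by exists g.
elim/mpolyind: f => [|c m p _ _ [g hg]].
  by exists 0; rewrite msym0 mulr0 subrr.
have [h hh]: exists g, 'X_[m] - msym s 'X_[m] = ('X_i - 'X_j) * g.
  rewrite mpolyXE_id; elim/big_ind: _ => [|x y hx hy|a _].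
  - by exists 0; rewrite msym1 mulr0 subrr.
  - exact: hM.
  elim: (m a) => [|d IH]; first by exists 0; rewrite expr0 msym1 mulr0 subrr.
  by rewrite exprS; apply: hM.
exists (c *: h + g); rewrite mulrDr -hg -scalerAr -hh msymD msymZ scalerBr; ring.
Qed.

(* The quotient is unique for i != j, by ddiffE and subX_neq0; only such i and
   j are used below. *)
Definition ddiff i j f : {mpoly int[n]} := xchoose (ddiff_exists i j f).

Lemma ddiffE i j f : ('X_i - 'X_j) * ddiff i j f = f - msym (tperm i j) f.
Proof. by rewrite -(eqP (xchooseP (ddiff_exists i j f))). Qed.

Lemma subX_neq0 i j : i != j -> 'X_i - 'X_j != 0 :> {mpoly int[n]}.
Proof.
move=> ne; rewrite subr_eq0; apply: contra ne => /eqP /(congr1 (mcoeff U_(i)%MM)).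
rewrite !mcoeffX eqxx; case: eqP => // /mnmP /(_ i); rewrite !mnm1E eqxx.
by rewrite eq_sym; case: eqP.
Qed.

Lemma ddiff_sym i j f : i != j -> msym (tperm i j) (ddiff i j f) = ddiff i j f.
Proof.
move=> ne; have x0 := subX_neq0 ne.
have := congr1 (msym (tperm i j)) (ddiffE i j f).
rewrite msymM !msymB !msymXi tpermL tpermR -msymMm tperm2 msym1m.
by rewrite -[RHS]opprB -ddiffE -mulNr opprB; apply: mulfI; rewrite subX_neq0 // eq_sym.
Qed.

Lemma ddiff_ddiff i j f : i != j -> ddiff i j (ddiff i j f) = 0.
Proof.
move=> ne; apply: (mulfI (subX_neq0 ne)).
by rewrite ddiffE ddiff_sym // subrr mulr0.
Qed.

Lemma ddiffC i j k l f : i != j -> k != l ->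
  i != k -> i != l -> j != k -> j != l ->
  ddiff i j (ddiff k l f) = ddiff k l (ddiff i j f).
Proof.
move=> nij nkl nik nil njk njl.
apply: (mulfI (subX_neq0 nij)); apply: (mulfI (subX_neq0 nkl)).
rewrite [RHS]mulrCA !ddiffE.
set s := tperm i j; set t := tperm k l.
have e1 : ('X_k - 'X_l) * msym s (ddiff k l f) = msym s f - msym s (msym t f).
  rewrite -msymB -ddiffE msymM msymB !msymXi /s !tpermD // 1?eq_sym //.
have e2 : ('X_i - 'X_j) * msym t (ddiff i j f) = msym t f - msym t (msym s f).
  by rewrite -msymB -ddiffE msymM msymB !msymXi /t !tpermD // eq_sym.
rewrite !mulrBr e1 e2 !ddiffE -!msymMm.
have -> : (s * t = t * s)%g.
  have e : (t ^ s = t)%g by rewrite /s /t tpermJ !tpermD.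
  by rewrite -{1}e conjgE mulKVg.
exact: subr_swap.
Qed.

Lemma tperm_braid i j k : i != j -> j != k -> i != k ->
  (tperm i j * tperm j k * tperm i j = tperm j k * tperm i j * tperm j k)%g.
Proof.
move=> nij njk nik; set s := tperm i j; set t := tperm j k.
have st : (s ^ t = t ^ s)%g.
  by rewrite /s /t !tpermJ tpermL tpermR !tpermD // eq_sym.
have ss : (s^-1 = s)%g by rewrite /s tpermV.
have tt : (t^-1 = t)%g by rewrite /t tpermV.
by move: st; rewrite !conjgE ss tt !mulgA => ->.
Qed.

Lemma ddiff_braid i j k f : i != j -> j != k -> i != k ->
  ddiff i j (ddiff j k (ddiff i j f)) = ddiff j k (ddiff i j (ddiff j k f)).
Proof.
move=> nij njk nik.
have a0 := subX_neq0 nij; have b0 := subX_neq0 njk; have c0 := subX_neq0 nik.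
set s := tperm i j; set t := tperm j k.
have brd : (s * t * s = t * s * t)%g by apply: tperm_braid.
have sk : s k = k by rewrite /s tpermD // eq_sym.
have ti : t i = i by rewrite /t tpermD // eq_sym.
have si : s i = j by rewrite /s tpermL.
have sj : s j = i by rewrite /s tpermR.
have tj : t j = k by rewrite /t tpermL.
have tk : t k = j by rewrite /t tpermR.
have eC : 'X_i - 'X_k = ('X_i - 'X_j) + ('X_j - 'X_k) :> {mpoly int[n]}.
  by rewrite addrA subrK.
have ss : involutive (@msym n int s) by move=> x; rewrite -msymMm tperm2 msym1m.
have tt : involutive (@msym n int t) by move=> x; rewrite -msymMm tperm2 msym1m.
have e1 : msym s ('X_i - 'X_j) = - ('X_i - 'X_j) :> {mpoly int[n]}.
  by rewrite msymB !msymXi si sj opprB.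
have e2 : msym t ('X_j - 'X_k) = - ('X_j - 'X_k) :> {mpoly int[n]}.
  by rewrite msymB !msymXi tj tk opprB.
have e3 : msym s ('X_j - 'X_k) = ('X_i - 'X_j) + ('X_j - 'X_k) :> {mpoly int[n]}.
  by rewrite msymB !msymXi sj sk eC.
have e4 : msym t ('X_i - 'X_j) = ('X_i - 'X_j) + ('X_j - 'X_k) :> {mpoly int[n]}.
  by rewrite msymB !msymXi ti tj eC.
rewrite eC in c0.
apply: (@braid_quotient _ (msym s) (msym t) _ _ f _ _ _ _ _ _ a0 b0 c0 e1 e2 e3 e4
  ss tt _ (ddiffE i j f) (ddiffE j k _) (ddiffE i j _)
  (ddiffE j k f) (ddiffE i j _) (ddiffE j k _)).
have msym3 x y z : msym z (msym y (msym x f)) = msym (x * y * z)%g f.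
  by rewrite !msymMm.
exact: (etrans (msym3 s t s) (etrans (congr1 (@msym n int ^~ f) brd) (esym (msym3 t s t)))).
Qed.
End DividedDifference.

Definition schubert_family n (S : {ffun 'S_n -> {mpoly int[n]}}) : bool :=
  (S (longest_perm n) == \prod_(i < n) 'X_i ^+ (n - i.+1)) &&
  [forall w : 'S_n, forall i : 'I_n, forall j : 'I_n, (j == i.+1 :> nat) ==>
     (ddiff i j (S w) ==
        if (perm_length (swap_positions i j w) < perm_length w)%N
        then S (swap_positions i j w) else 0)].

Section Existence.
Variable n : nat.
Implicit Types (i j k l : 'I_n) (w v : 'S_n).

Lemma swap_positionsK i j w : swap_positions i j (swap_positions i j w) = w.
Proof. by rewrite /swap_positions mulgA tperm2 mul1g. Qed.

Lemma perm_length_ascent i j w : j = i.+1 :> nat -> (w i < w j)%N ->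
  perm_length (swap_positions i j w) = (perm_length w).+1.
Proof.
move=> ji wij; rewrite /perm_length.
pose f (p : 'I_n * 'I_n) := (tperm i j p.1, tperm i j p.2).
have fK : involutive f by case=> a b; rewrite /f /= !tpermK.
have -> : inversions (swap_positions i j w) = (i, j) |: f @^-1: inversions w.
  apply/setP=> -[a b]; rewrite !inE /f /= !swap_positionsE xpair_eqE -!val_eqE /=.
  case: (tpermP i j a) => [->|->|/eqP + /eqP +];
  case: (tpermP i j b) => [->|->|/eqP + /eqP +];
  rewrite -?val_eqE /=; lia.
have -> : f @^-1: inversions w = f @: inversions w by rewrite (can2_imset_pre _ fK fK).
rewrite cardsU1 card_imset; last exact: can_inj fK.
rewrite (can2_imset_pre _ fK fK) !inE /f /= tpermL tpermR.
by have -> : (j < i)%N = false by lia.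
Qed.

Lemma perm_length_lt i j w : j = i.+1 :> nat ->
  (perm_length (swap_positions i j w) < perm_length w)%N = (w j < w i)%N.
Proof.
move=> ji; case: (ltngtP (w j) (w i)) => [h|h|/ord_inj/perm_inj/(congr1 val)/=]; last by lia.
- have := @perm_length_ascent i j (swap_positions i j w) ji.
  by rewrite swap_positionsK !swap_positionsE tpermL tpermR => /(_ h) ->; rewrite ltnSn.
- by rewrite perm_length_ascent //; lia.
Qed.

Lemma perm_length_bound w : (perm_length w <= n * n)%N.
Proof. by rewrite (leq_trans (max_card _)) // card_prod card_ord. Qed.

Lemma longest_permE w :
  (forall i j, j = i.+1 :> nat -> (w j < w i)%N) -> w = longest_perm n.
Proof.
move=> desc; apply/permP=> i; rewrite permE; apply: val_inj => /=.
have up m : forall i, i = m :> nat -> (w i + m < n)%N.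
  elim: m => [|m IH] a am; first by rewrite addn0.
  have hm : (m < n)%N by have := ltn_ord a; lia.
  have := IH (Ordinal hm) erefl; have := desc (Ordinal hm) a; rewrite /=; lia.
have dn m : forall i, n = (i + m).+1 -> (m <= w i)%N.
  elim: m => [|m IH] // a am.
  have hm : (a.+1 < n)%N by lia.
  have := IH (Ordinal hm); have := desc a (Ordinal hm) erefl; rewrite /=; lia.
have := up _ i erefl; have := dn (n - i.+1)%N i; have := ltn_ord i; lia.
Qed.

(* An explicit family, following one chain of ascents from w to the longest
   permutation; it serves only to prove schubert_exists. *)
Definition ascent w (p : 'I_n * 'I_n) : bool :=
  (p.2 == p.1.+1 :> nat) && (w p.1 < w p.2)%N.

Fixpoint schubert_fuel m w : {mpoly int[n]} :=
  if m is m'.+1 then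
    if [pick p | ascent w p] is Some p
    then ddiff p.1 p.2 (schubert_fuel m' (swap_positions p.1 p.2 w))
    else \prod_(i < n) 'X_i ^+ (n - i.+1)
  else 0.

Lemma schubert_fuelS m w : schubert_fuel m.+1 w =
    if [pick p | ascent w p] is Some p
    then ddiff p.1 p.2 (schubert_fuel m (swap_positions p.1 p.2 w))
    else \prod_(i < n) 'X_i ^+ (n - i.+1).
Proof. by []. Qed.

Definition codim w := (n * n - perm_length w)%N.

Lemma codim_ascent w p : ascent w p ->
  codim w = (codim (swap_positions p.1 p.2 w)).+1.
Proof.
move=> /andP[/eqP e lt]; have := perm_length_bound (swap_positions p.1 p.2 w).
by rewrite /codim perm_length_ascent //; lia.
Qed.

Definition schubert_cand w := schubert_fuel (codim w).+1 w.

Lemma schubert_candE w : schubert_cand w = if [pick p | ascent w p] is Some p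
    then ddiff p.1 p.2 (schubert_cand (swap_positions p.1 p.2 w))
    else \prod_(i < n) 'X_i ^+ (n - i.+1).
Proof.
rewrite {1}/schubert_cand schubert_fuelS; case: pickP => [p /codim_ascent e|_]; last reflexivity.
rewrite e; reflexivity.
Qed.

Lemma schubert_cand_ascent_aux m w i j : codim w = m -> ascent w (i, j) ->
  schubert_cand w = ddiff i j (schubert_cand (swap_positions i j w)).
Proof.
elim/ltn_ind: m w i j => m IH w i j wm aij.
have {}IH v p : (codim v < codim w)%N -> ascent v p ->
    schubert_cand v = ddiff p.1 p.2 (schubert_cand (swap_positions p.1 p.2 v)).
  by rewrite wm; case: p => /= a b h; exact: (IH _ h _ _ _ erefl).
clear m wm.
have braid i1 i2 i3 : i2 = i1.+1 :> nat -> i3 = i2.+1 :> nat ->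
    (w i1 < w i2)%N -> (w i2 < w i3)%N ->
    ddiff i1 i2 (schubert_cand (swap_positions i1 i2 w)) =
    ddiff i2 i3 (schubert_cand (swap_positions i2 i3 w)).
  move=> e12 e23 w12 w23.
  have n12 : i1 != i2 by rewrite -val_eqE /=; lia.
  have n23 : i2 != i3 by rewrite -val_eqE /=; lia.
  have n13 : i1 != i3 by rewrite -val_eqE /=; lia.
  have a12 : ascent w (i1, i2) by apply/andP; rewrite /= e12.
  have a23 : ascent w (i2, i3) by apply/andP; rewrite /= e23.
  set s := swap_positions i1 i2; set t := swap_positions i2 i3.
  have sE v k : s v k = v (tperm i1 i2 k) by apply: swap_positionsE.
  have tE v k : t v k = v (tperm i2 i3 k) by apply: swap_positionsE.
  have s1 : tperm i1 i2 i1 = i2 by rewrite tpermL.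
  have s2 : tperm i1 i2 i2 = i1 by rewrite tpermR.
  have s3 : tperm i1 i2 i3 = i3 by rewrite tpermD // eq_sym.
  have t1 : tperm i2 i3 i1 = i1 by rewrite tpermD // eq_sym.
  have t2 : tperm i2 i3 i2 = i3 by rewrite tpermL.
  have t3 : tperm i2 i3 i3 = i2 by rewrite tpermR.
  have as1 : ascent (s w) (i2, i3) by apply/andP; rewrite /= e23 !sE s2 s3; lia.
  have as2 : ascent (t (s w)) (i1, i2).
    by apply/andP; rewrite /= e12 !tE t1 t2 !sE s1 s3; lia.
  have at1 : ascent (t w) (i1, i2) by apply/andP; rewrite /= e12 !tE t1 t2; lia.
  have at2 : ascent (s (t w)) (i2, i3).
    by apply/andP; rewrite /= e23 !sE s2 s3 !tE t1 t3; lia.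
  have cs : (codim (s w) < codim w)%N by rewrite (codim_ascent a12).
  have ct : (codim (t w) < codim w)%N by rewrite (codim_ascent a23).
  have cs1 : (codim (t (s w)) < codim w)%N.
    by apply: ltn_trans cs; rewrite (codim_ascent as1).
  have ct1 : (codim (s (t w)) < codim w)%N.
    by apply: ltn_trans ct; rewrite (codim_ascent at1).
  rewrite (IH _ _ cs as1) (IH _ _ cs1 as2) (IH _ _ ct at1) (IH _ _ ct1 at2) /= -/s -/t.
  have -> : t (s (t w)) = s (t (s w)) by rewrite /s /t /swap_positions !mulgA tperm_braid.
  exact: (ddiff_braid _ n12 n23 n13).
rewrite schubert_candE; case: pickP => [[k l] akl|/(_ (i, j))]; last by rewrite aij.
rewrite /=.
move: (aij) (akl) => /andP[/= /eqP ji wij] /andP[/= /eqP lk wkl].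
have [eik|nik] := eqVneq i k.
  have -> : k = i by [].
  by have -> : l = j by apply: val_inj; rewrite /= lk ji eik.
have [ejk|njk] := eqVneq j k.
  by subst k; apply/esym/braid.
have [eli|nli] := eqVneq l i.
  by subst l; apply/braid.
have nij : i != j by rewrite -val_eqE /=; lia.
have nkl : k != l by rewrite -val_eqE /=; lia.
have njl : j != l by rewrite -val_eqE /= ji lk; move: nik; rewrite -val_eqE /=; lia.
have nil : i != l by rewrite eq_sym.
have tE (a b c d : 'I_n) : a != c -> a != d -> b != c -> b != d ->
    ascent w (a, b) -> ascent (swap_positions c d w) (a, b).
  move=> ac ad bc bd /andP[/= e lt]; apply/andP; split=> //=.
  by rewrite !swap_positionsE !tpermD // eq_sym.
have ak : ascent (swap_positions i j w) (k, l) by apply: tE => //; rewrite eq_sym.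
have ai : ascent (swap_positions k l w) (i, j) by apply: tE.
rewrite (IH _ _ _ ai) /=; last by rewrite (codim_ascent akl).
rewrite (IH _ _ _ ak) /=; last by rewrite (codim_ascent aij).
have -> : swap_positions k l (swap_positions i j w) =
          swap_positions i j (swap_positions k l w).
  have e : (tperm k l ^ tperm i j = tperm k l)%g by rewrite tpermJ !tpermD.
  by rewrite /swap_positions !mulgA -{2}e conjgE mulKVg.
exact: (esym (ddiffC _ nij nkl nik nil njk njl)).
Qed.

Lemma schubert_cand_ascent w i j : j = i.+1 :> nat -> (w i < w j)%N ->
  schubert_cand w = ddiff i j (schubert_cand (swap_positions i j w)).
Proof. by move=> ji wij; apply: (schubert_cand_ascent_aux erefl); apply/andP; rewrite /= ji. Qed.

Lemma schubert_exists : exists S, @schubert_family n S.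
Proof.
exists [ffun w => schubert_cand w]; apply/andP; split.
  rewrite ffunE schubert_candE; case: pickP => // p /andP[/eqP e]; rewrite !permE /=.
  have := ltn_ord p.2; lia.
apply/forallP=> w; apply/forallP=> i; apply/forallP=> j; apply/implyP=> /eqP ji.
rewrite !ffunE perm_length_lt //.
have nij : i != j by rewrite -val_eqE /=; lia.
case: ltnP => wij.
  rewrite [schubert_cand (swap_positions i j w)](schubert_cand_ascent ji) ?swap_positionsK //.
  by rewrite !swap_positionsE tpermL tpermR.
rewrite (schubert_cand_ascent ji) ?ddiff_ddiff // ltn_neqAle wij andbT.
by rewrite val_eqE (inj_eq perm_inj).
Qed.

Definition schubert : 'S_n -> {mpoly int[n]} := xchoose schubert_exists.

Lemma schubert_familyP : schubert_family (xchoose schubert_exists).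
Proof. exact: xchooseP. Qed.

Lemma schubert_longest :
  schubert (longest_perm n) = \prod_(i < n) 'X_i ^+ (n - i.+1).
Proof. by case/andP: schubert_familyP => /eqP. Qed.

Lemma schubert_family_ddiff S : schubert_family S -> forall i j w, j = i.+1 :> nat ->
  ddiff i j (S w) =
    if (perm_length (swap_positions i j w) < perm_length w)%N
    then S (swap_positions i j w) else 0.
Proof.
move=> /andP[_ /forallP h] i j w ji.
by have /forallP /(_ i) /forallP /(_ j) /implyP h1 := h w; apply/eqP/h1/eqP.
Qed.

Lemma schubert_ddiff i j w : j = i.+1 :> nat ->
  ddiff i j (schubert w) =
    if (perm_length (swap_positions i j w) < perm_length w)%N
    then schubert (swap_positions i j w) else 0.
Proof. exact: schubert_family_ddiff schubert_familyP i j w. Qed.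

Lemma schubert_family_uniq (S T : {ffun 'S_n -> {mpoly int[n]}}) :
  schubert_family S -> schubert_family T -> S = T.
Proof.
move=> hS hT; apply/ffunP=> w.
elim/ltn_ind: {w}(codim w) {-2}w (erefl (codim w)) => m IH w wm.
case: (pickP (ascent w)) => [[i j] a|noasc].
  have cw := codim_ascent a; move: (a) => /andP[/= /eqP ji wij].
  have up X : schubert_family X -> X w = ddiff i j (X (swap_positions i j w)).
    move=> /schubert_family_ddiff ->//.
    by rewrite swap_positionsK perm_length_ascent // ltnSn.
  rewrite (up S hS) (up T hT).
  have -> // : S (swap_positions i j w) = T (swap_positions i j w).
  by apply: (IH (codim (swap_positions i j w))) => //; rewrite -wm cw.
have -> : w = longest_perm n.
  apply: longest_permE => i j ji; have := noasc (i, j).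
  rewrite /ascent /= ji eqxx /= => /negbT; rewrite -leqNgt leq_eqVlt.
  by case/orP=> // /eqP/ord_inj/perm_inj/(congr1 val) /=; lia.
by case/andP: hS => /eqP -> _; case/andP: hT => /eqP ->.
Qed.
End Existence.

(* Main.v *)
Require Import Defs.
From HB Require Import structures.
From mathcomp Require Import all_boot all_order all_algebra all_fingroup.
From mathcomp Require Import mpoly ring zify.

Set Implicit Arguments.
Unset Strict Implicit.
Unset Printing Implicit Defensive.

Import GRing.Theory.
Local Open Scope ring_scope.

(** Write S_w for the Schubert polynomial, with variables x_0, ..., x_(n-1),
    c = ccode w, and m(w) for the product over all positions l of
    x_0 x_1 ... x_(c_l - 1), which is the monomial of the theorem
    ([ccode_monomial]).

    The idea is to compute S_w by feeding in its variables one at a time.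
    Substituting (x_0, ..., x_(k-1), 0, ..., 0, x_k, 0, ..., 0), with x_k in
    position i >= k, into the defining identity
    (x_i - x_(i+1)) ddiff f = f - s_i f gives, for f = S_w, the recursion
      P(k, i, w) = P(k, i+1, w) + [w has a descent at i] x_k P(k, i+1, w s_i)
    for the resulting polynomials P ([shift_var_schubert]).  When x_k reaches
    the last position it disappears, because x_(n-1) does not occur in S_w, and
    what is left is S_w(x_0, ..., x_(k-1), 0, ..., 0) = P(k-1, k-1, w).  So all
    of S_w is recovered, by positive rules, from constant terms, that is, from
    the constant term of S_1: by homogeneity the others vanish.

    The combinatorial input is [ccode_swap]: passing from w to w s_i at a
    descent exchanges the code entries at i and i+1 and lowers by one the one
    that was at i+1.  Lowering an entry c to c-1 divides m(w) by x_(c-1)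
    ([ccode_monomial_swap]).  With k+1 variables one can use up k+1 units of
    each code entry, and the entries at positions <= i, which x_k can no longer
    lower, must be at most k.  This is the bound [ccode_bounded], and the
    invariant [lex_min_if_bounded] says that P(k, i, w) is 0 if the bound fails
    and has m(w) as its lexicographically minimal term, with a coefficient that
    does not depend on w, if it holds.  In the recursion, if the entry c at
    position i+1 is k+1, then the first summand is 0 and the second contributes
    x_k m(w s_i) = m(w); if c <= k, then the first summand contributes m(w) and
    the minimal term of the second, x_k m(w) / x_(c-1), is larger.

    Taking all the variables, m(w) is the minimal monomial of S_w for every w,
    with the same coefficient for all w.  This coefficient is 1 since it is 1
    for the longest permutation. *)

(** * Monomials of divided differences *)

Section Ddiff.
Variable n : nat.
Implicit Types (i j l : 'I_n) (f g : {mpoly int[n]}) (m r : 'X_{1..n}).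

Lemma ddiff_linear i j : i != j -> linear (@ddiff n i j).
Proof.
move=> ne c f g; apply: (mulfI (subX_neq0 ne)).
rewrite ddiffE msymD msymZ mulrDr -scalerAr !ddiffE scalerBr; ring.
Qed.

Lemma ddiff_monomial i j r a b : i != j -> r i = 0%N -> r j = 0%N -> (b <= a)%N ->
  ddiff i j 'X_[r + U_(i) *+ a + U_(j) *+ b] =
  \sum_(l < a - b) 'X_[r + U_(i) *+ (a - l.+1) + U_(j) *+ (b + l)].
Proof.
move=> ne ri rj leba; apply: (mulfI (subX_neq0 ne)).
have sr : msym (tperm i j) 'X_[r] = 'X_[r] :> {mpoly int[n]}.
  rewrite msymX; congr mpolyX; apply/mnmP=> l; rewrite mnmE tpermV.
  by case: tpermP => [->|->|//]; rewrite ri rj.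
rewrite ddiffE !mpolyXD -!mpolyXn !msymM sr !rmorphXn /= !msymXi tpermL tpermR.
have -> : \sum_(l < a - b) 'X_[r + U_(i) *+ (a - l.+1) + U_(j) *+ (b + l)] =
    'X_[r] * 'X_i ^+ b * 'X_j ^+ b *
      \sum_(l < a - b) 'X_i ^+ ((a - b).-1 - l) * 'X_j ^+ l :> {mpoly int[n]}.
  rewrite mulr_sumr; apply: eq_bigr => l _.
  rewrite !mpolyXD -!mpolyXn.
  have -> : (a - l.+1 = b + ((a - b).-1 - l))%N by have := ltn_ord l; lia.
  by rewrite !exprD; ring.
rewrite mulrCA; have /= <- := subrXX ('X_i : {mpoly int[n]}) 'X_j (a - b).
by rewrite -{1 2}(subnKC leba) !exprD; ring.
Qed.

Lemma ddiff_msym i j f : i != j -> ddiff i j (msym (tperm i j) f) = - ddiff i j f.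
Proof.
move=> ne; apply: (mulfI (subX_neq0 ne)).
by rewrite mulrN !ddiffE -msymMm tperm2 msym1m opprB.
Qed.

(** Dividing x^a y^b - x^b y^a by x - y leaves a geometric sum whose exponents
    lie between min(a, b) and max(a, b) - 1.  This is what keeps Schubert
    polynomials homogeneous and below the staircase. *)
Lemma msupp_ddiff i j f m' : i != j -> m' \in msupp (ddiff i j f) ->
  exists2 m, m \in msupp f &
  [/\ (m' i + m' j).+1 = (m i + m j)%N, (m' i < maxn (m i) (m j))%N,
      (m' j < maxn (m i) (m j))%N & forall l, l != i -> l != j -> m' l = m l].
Proof.
move=> ne; pose F := GRing.isLinear.Build _ _ _ _ (@ddiff n i j) (ddiff_linear ne).
pose D : {linear {mpoly int[n]} -> {mpoly int[n]}} := HB.pack (@ddiff n i j) F.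
rewrite -[ddiff i j f]/(D f) {1}(mpolyE f) linear_sum /=.
move=> /msupp_sum_le /flattenP /= [s /mapP [m]].
rewrite filter_predT => mf -> {s}; rewrite -[ddiff i j _]/(D _) linearZ => /msuppZ_le.
rewrite [D _]/= => m'm; exists m => // {mf}.
pose r : 'X_{1..n} := [multinom if (l == i) || (l == j) then 0%N else m l | l < n].
have ri : r i = 0%N by rewrite mnmE eqxx.
have rj : r j = 0%N by rewrite mnmE eqxx orbT.
have rl l : l != i -> l != j -> r l = m l by rewrite mnmE => /negbTE -> /negbTE ->.
have ji : (j == i) = false by rewrite eq_sym (negbTE ne).
have main a b : (b <= a)%N ->
    m' \in msupp (ddiff i j 'X_[r + U_(i) *+ a + U_(j) *+ b]) ->
  [/\ (m' i + m' j).+1 = (a + b)%N, (m' i < a)%N,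
      (m' j < a)%N & forall l, l != i -> l != j -> m' l = m l].
  move=> ba; rewrite ddiff_monomial // => /msupp_sum_le /flattenP /= [s /mapP [l _ ->]].
  have := ltn_ord l; rewrite msuppX inE => la /eqP ->.
  rewrite !mnmDE !mulmnE !mnm1E !eqxx ji (negbTE ne) ri rj.
  split; try lia.
  move=> q /[dup] qi /negbTE iq /[dup] qj /negbTE jq.
  by rewrite !mnmDE !mulmnE !mnm1E (eq_sym i) (eq_sym j) iq jq rl // !mul0n !addn0.
(* A monomial whose exponent at j is the larger one is the image under s_ij of
   one of the form treated above; its divided difference changes sign. *)
case: (leqP (m j) (m i)) => h.
  have em : m = (r + U_(i) *+ m i + U_(j) *+ m j)%MM.
    apply/mnmP=> q; rewrite !mnmDE !mulmnE !mnm1E (eq_sym i) (eq_sym j) mnmE.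
    case: (eqVneq q i) => [->|_] /=; first by rewrite (negbTE ne); lia.
    by case: (eqVneq q j) => [->|_] /=; lia.
  by move: m'm; rewrite {1}em => /(main _ _ h).
have em : m = [multinom (r + U_(i) *+ m j + U_(j) *+ m i)%MM (tperm i j q) | q < n].
  apply/mnmP=> q; rewrite mnmE !mnmDE !mulmnE !mnm1E (eq_sym i) (eq_sym j) mnmE.
  case: tpermP => [->|->|/eqP/negbTE h1 /eqP/negbTE h2]; rewrite ?eqxx ?ji ?(negbTE ne) ?h1 ?h2 /=; lia.
have em' : 'X_[m] = msym (tperm i j) 'X_[r + U_(i) *+ m j + U_(j) *+ m i] :> {mpoly int[n]}.
  by rewrite msymX tpermV {1}em.
move: m'm; rewrite em' ddiff_msym // (perm_mem (msuppN _)) => /(main _ _ (ltnW h)).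
by rewrite (addnC (m j)).
Qed.

End Ddiff.

(** * Substitution of polynomials for the variables *)

Section Substitution.
Variables (n : nat) (R S : comNzRingType) (phi : {rmorphism R -> S}).

Lemma mmap_msym (h : 'I_n -> S) (s : 'S_n) (f : {mpoly R[n]}) :
  mmap phi h (msym s f) = mmap phi (h \o s) f.
Proof.
rewrite {1 2}(mpolyE f) [msym s _]raddf_sum [LHS]raddf_sum [RHS]raddf_sum /=.
apply: eq_bigr => m _; rewrite msymZ -!mul_mpolyC !rmorphM /= !mmapC msymX !mmapX.
congr (_ * _); rewrite /mmap1 (reindex_inj (@perm_inj _ s)) /=.
by apply: eq_bigr => i _; rewrite mnmE permK.
Qed.

Lemma eq_mmap_msupp (h1 h2 : 'I_n -> S) (f : {mpoly R[n]}) :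
  (forall m i, m \in msupp f -> m i != 0%N -> h1 i = h2 i) ->
  mmap phi h1 f = mmap phi h2 f.
Proof.
move=> e; rewrite /mmap !big_seq; apply: eq_bigr => m mf; congr (_ * _).
rewrite /mmap1; apply: eq_bigr => i _.
by case: (eqVneq (m i) 0%N) => [->//|/(e m i mf) ->].
Qed.

Lemma mmap_zero (f : {mpoly R[n]}) : mmap phi (fun=> 0) f = phi f@_0%MM.
Proof.
rewrite {1}(mpolyE f) raddf_sum [in RHS](mpolyE f) !raddf_sum /=.
apply: eq_bigr => m _; rewrite -mul_mpolyC rmorphM /= mmapC mmapX.
rewrite mul_mpolyC mcoeffZ mcoeffX rmorphM rmorph_nat; congr (_ * _).
case: eqP => [->|/eqP]; first by rewrite mmap11.
rewrite -mdeg_eq0 mdegE sum_nat_eq0 => /forallPn /= [i mi].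
by rewrite /mmap1 (bigD1 i) //= expr0n (negbTE mi) mul0r.
Qed.

End Substitution.

Lemma mmap_id n (R : comNzRingType) (f : {mpoly R[n]}) :
  mmap (@mpolyC n R) (fun i => 'X_i) f = f.
Proof.
rewrite {2}(mpolyE f) /mmap; apply: eq_bigr => m _.
by rewrite mul_mpolyC mmap1_id.
Qed.

(** * Column codes and descents *)

Section Ccode.
Variable n : nat.
Implicit Types (i j k l o : 'I_n) (w : 'S_n) (a b m : 'X_{1..n}).

Lemma ccodeE w i : ccode w i = #|[set l : 'I_n | (l < i)%N && (w i < w l)%N]|.
Proof. by apply: eq_card => l; rewrite !inE /= andbA andbb. Qed.

Lemma card_ord_lt i : #|[set l : 'I_n | (l < i)%N]| = i.
Proof.
rewrite -sum1dep_card -(big_ord_widen n (fun=> 1%N)) ?(ltnW (ltn_ord i)) //.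
by rewrite sum1_card card_ord.
Qed.

Lemma ccode_leq w i : (ccode w i <= i)%N.
Proof.
rewrite ccodeE.
by rewrite -[leqRHS]card_ord_lt; apply/subset_leq_card/subsetP=> l; rewrite !inE => /andP[].
Qed.

Lemma ccode_longest i : ccode (longest_perm n) i = i.
Proof.
rewrite ccodeE -[RHS]card_ord_lt.
by apply: eq_card => l; rewrite !inE !permE /=; have := ltn_ord i; lia.
Qed.

Lemma ccode_descent w i j : j = i.+1 :> nat ->
  (ccode w i < ccode w j)%N = (w j < w i)%N.
Proof.
move=> ji; rewrite !ccodeE; case: (ltnP (w j) (w i)) => h.
  apply: proper_card; apply/properP; split.
    by apply/subsetP => l; rewrite !inE; lia.
  by exists i; rewrite !inE; lia.
apply/negbTE; rewrite -leqNgt; apply: subset_leq_card.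
apply/subsetP => l; rewrite !inE => /andP[lj wl]; rewrite (leq_ltn_trans h wl) andbT.
have : l != i by apply/eqP=> li; move: wl; rewrite li; lia.
by rewrite -val_eqE /=; lia.
Qed.

(** At a descent in positions i, j = i+1, the entry w_j acquires no new larger
    entry to its left when it moves to position i, and loses w_i; all other
    entries keep the larger entries on their left. *)
Lemma ccode_swap w i j l : j = i.+1 :> nat -> (w j < w i)%N ->
  ccode w l = (ccode (swap_positions i j w) (tperm i j l) + (l == j))%N.
Proof.
move=> ji wji; rewrite !ccodeE.
set A := [set _ | _]; set B := [set _ | _].
have -> : A = tperm i j @^-1: B :|: (if l == j then [set i] else set0).
  apply/setP=> x.
  have -> : (x \in tperm i j @^-1: B :|: (if l == j then [set i] else set0)) =
      (tperm i j x < tperm i j l)%N && (w l < w x)%N || (l == j) && (x == i).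
    by rewrite !inE !swap_positionsE !tpermK; case: (l == j); rewrite inE.
  rewrite inE; case: (tpermP i j x) => [->|->|/eqP + /eqP +];
  case: (tpermP i j l) => [->|->|/eqP + /eqP +]; rewrite -?val_eqE /=; lia.
rewrite cardsU.
have -> : tperm i j @^-1: B :&: (if l == j then [set i] else set0) = set0.
  apply/setP=> x; rewrite !inE; case: eqP => [->|_]; rewrite !inE ?andbF //.
  case: eqP => [->|_]; rewrite ?andbF //.
  by rewrite tpermL tpermR ltnNge ltnW // ji.
rewrite cards0 subn0 card_preimset; last exact: perm_inj.
by congr (_ + _)%N; case: eqP; rewrite ?cards1 ?cards0.
Qed.

Definition ccode_monomial w : 'X_{1..n} :=
  [multinom #|[set l : 'I_n | (i < ccode w l)%N]| | i < n].

Lemma ccode_monomialE w i : ccode_monomial w i = (\sum_l (i < ccode w l)%N)%N.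
Proof. by rewrite mnmE -sum1dep_card big_mkcond. Qed.

(** Lowering a code entry from o+1 to o changes only the number of entries that
    exceed o. *)
Lemma ccode_monomial_swap w i j o : j = i.+1 :> nat -> (w j < w i)%N ->
  o = ccode (swap_positions i j w) i :> nat ->
  ccode_monomial w = (ccode_monomial (swap_positions i j w) + U_(o))%MM.
Proof.
move=> ji wji oE; apply/mnmP=> p; rewrite mnmDE mnm1E !ccode_monomialE.
rewrite (reindex_inj (@perm_inj _ (tperm i j))) /=.
rewrite (bigD1 i) //= [in RHS](bigD1 i) //= [RHS]addnAC; congr (_ + _)%N.
  by rewrite (ccode_swap _ ji wji) tpermK tpermL eqxx -oE -val_eqE /=; lia.
apply: eq_bigr => l ni; rewrite (ccode_swap _ ji wji) tpermK.
have -> : (tperm i j l == j) = false.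
  by rewrite -[X in _ == X](tpermL i j) (inj_eq perm_inj) (negbTE ni).
by rewrite addn0.
Qed.

Lemma ccode_monomial_longest i : ccode_monomial (longest_perm n) i = (n - i.+1)%N.
Proof.
rewrite ccode_monomialE.
under eq_bigr => l _ do rewrite ccode_longest.
rewrite -[RHS](card_ord_lt (rev_ord i)) -sum1dep_card [RHS]big_mkcond /=.
rewrite (reindex_inj rev_ord_inj) /=; apply: eq_bigr => l _.
have := ltn_ord l; have := ltn_ord i; by case: ifP; lia.
Qed.

Lemma perm_ascents w :
  (forall i j, j = i.+1 :> nat -> (w i < w j)%N) -> w = 1%g.
Proof.
move=> asc; apply: (mulIg (longest_perm n)); rewrite mul1g.
apply: longest_permE => i j ji; rewrite !permM !permE /=.
by have := asc _ _ ji; have := ltn_ord (w j); have := ltn_ord (w i); lia.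
Qed.

End Ccode.

(** * Lexicographically minimal terms *)

Section LexMin.
Variable n : nat.
Implicit Types (i j k l o : 'I_n) (a b m : 'X_{1..n}) (p q : {mpoly int[n]}).

Lemma mlex_lt_trans a b m : mlex_lt a b -> mlex_lt b m -> mlex_lt a m.
Proof.
move=> /existsP[i /andP[abi /forallP abE]] /existsP[j /andP[bmj /forallP bmE]].
have abE' l : (i < l)%N -> a l = b l by move=> h; apply/eqP; have := abE l; rewrite h.
have bmE' l : (j < l)%N -> b l = m l by move=> h; apply/eqP; have := bmE l; rewrite h.
have main (o : 'I_n) : (a o < m o)%N -> (i <= o)%N -> (j <= o)%N -> mlex_lt a m.
  move=> lt io jo; apply/existsP; exists o; rewrite lt; apply/forallP=> l.
  by apply/implyP=> ol; rewrite abE' ?bmE' //; lia.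
case: (ltngtP i j) => [h|h|/ord_inj e].
- by apply: (main j) => //; [rewrite abE' | lia].
- by apply: (main i) => //; [rewrite -bmE' | lia].
- by subst j; apply: (main i) => //; apply: ltn_trans bmj.
Qed.

Lemma mlex_lt_add2r a b m : mlex_lt (a + m)%MM (b + m)%MM = mlex_lt a b.
Proof.
rewrite /mlex_lt; apply: eq_existsb => i; rewrite !mnmDE ltn_add2r; congr andb.
by apply: eq_forallb => l; rewrite !mnmDE eqn_add2r.
Qed.

Lemma mlex_lt_U i j : mlex_lt U_(i)%MM U_(j)%MM = (i < j)%N.
Proof.
apply/existsP/idP=> [[o /andP[]]|ij].
  rewrite !mnm1E => h /forallP /(_ i); rewrite !mnm1E eqxx.
  have jo : j = o by apply/eqP; move: h; case: (j == o); rewrite ?ltn0.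
  subst o; move: h; rewrite eqxx -!val_eqE /=; lia.
exists j; rewrite !mnm1E eqxx -!val_eqE /= ltn_eqF //=; apply/forallP=> l.
by rewrite !mnm1E -!val_eqE /=; apply/implyP=> jl; lia.
Qed.

Definition lex_min_term (c : int) m p : Prop :=
  p@_m = c /\ forall a, a \in msupp p -> a != m -> mlex_lt m a.

Lemma lex_min_term_mulX c m p k :
  lex_min_term c m p -> lex_min_term c (m + U_(k))%MM (p * 'X_k).
Proof.
move=> [pm pmin]; split=> [|a]; first by rewrite addmC mcoeffMX.
rewrite (perm_mem (msuppMX _ _)) => /mapP [b bp ->].
by rewrite (addmC m) (inj_eq (@addmI _ _)) !(addmC U_(k)%MM) mlex_lt_add2r; apply: pmin.
Qed.

Lemma lex_min_term_addr c d m b p q :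
  lex_min_term c m p -> lex_min_term d b q -> mlex_lt m b ->
  lex_min_term c m (p + q).
Proof.
move=> [pm pmin] [_ qmin] mb.
have lt a : a \in msupp q -> mlex_lt m a.
  by have [->//|nab] := eqVneq a b; move=> /qmin /(_ nab); apply: mlex_lt_trans.
split=> [|a /msuppD_le]; last by rewrite mem_cat => /orP[/pmin//|/lt].
rewrite mcoeffD pm memN_msupp_eq0 ?addr0 //; apply/negP => /lt.
by case/existsP=> i; rewrite ltnn.
Qed.

End LexMin.

(** * Monomials of Schubert polynomials *)

Section Schubert.
Variable n : nat.
Implicit Types (i j l : 'I_n) (w : 'S_n) (m : 'X_{1..n}).

(** Every permutation is reached from the longest one through a chain of
    descents. *)
Lemma schubert_ind (P : 'S_n -> {mpoly int[n]} -> Prop) :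
  P (longest_perm n) (schubert (longest_perm n)) ->
  (forall w i j, j = i.+1 :> nat -> (w j < w i)%N ->
     P w (schubert w) -> P (swap_positions i j w) (ddiff i j (schubert w))) ->
  forall w, P w (schubert w).
Proof.
move=> P0 PS w; elim/ltn_ind: {w}(codim w) {-2}w (erefl (codim w)) => d IH w wd.
case: (pickP (ascent w)) => [[i j] asc|noasc].
  have cw := codim_ascent asc; move: asc => /andP[/= /eqP ji wij].
  have := PS (swap_positions i j w) i j ji.
  rewrite swap_positionsK !swap_positionsE tpermL tpermR => /(_ wij).
  rewrite (schubert_ddiff _ ji) swap_positionsK perm_length_ascent // ltnSn; apply.
  by apply: (IH (codim (swap_positions i j w))) => //; rewrite -wd cw.
suff -> : w = longest_perm n by [].
apply: longest_permE => i j ji; rewrite ltnNge leq_eqVlt.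
apply/negP => /orP [/eqP/ord_inj/perm_inj/(congr1 val) /=|wij]; first by lia.
by have := noasc (i, j); rewrite /ascent /= ji eqxx wij.
Qed.

Lemma schubert_longestE :
  schubert (longest_perm n) = 'X_[ccode_monomial (longest_perm n)].
Proof.
rewrite schubert_longest mpolyXE_id; apply: eq_bigr => i _.
by rewrite ccode_monomial_longest.
Qed.

(** For the last variable the bound is 0: it does not occur at all. *)
Lemma msupp_schubert_staircase w m i : m \in msupp (schubert w) -> (m i <= n - i.+1)%N.
Proof.
move: w m i; apply: (@schubert_ind (fun w p =>
  forall m i, m \in msupp p -> (m i <= n - i.+1)%N)) => [m i|w i j ji wji IH m l].
  by rewrite schubert_longestE msuppX inE => /eqP ->; rewrite ccode_monomial_longest.
have ne : i != j by rewrite -val_eqE /=; lia.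
move=> /(msupp_ddiff ne) [a /IH {}IH [_ mi mj ml]].
have [->|nli] := eqVneq l i; first by have := IH i; have := IH j; lia.
have [->|nlj] := eqVneq l j; first by have := IH i; have := IH j; lia.
by rewrite ml.
Qed.

Lemma msupp_schubert_mdeg w m : m \in msupp (schubert w) -> mdeg m = mdeg (ccode_monomial w).
Proof.
move: w m; apply: (@schubert_ind (fun w p =>
  forall m, m \in msupp p -> mdeg m = mdeg (ccode_monomial w))) => [m|w i j ji wji IH m].
  by rewrite schubert_longestE msuppX inE => /eqP ->.
have ne : i != j by rewrite -val_eqE /=; lia.
move=> /(msupp_ddiff ne) [a /IH {}IH [e _ _ ml]]; apply: succn_inj.
have lt : (ccode (swap_positions i j w) i < n)%N by apply: leq_ltn_trans (ccode_leq _ _) _.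
move: IH; rewrite (@ccode_monomial_swap _ w i j (Ordinal lt)) // mdegD mdeg1 addn1 => <-.
have mdegij (x : 'X_{1..n}) :
    mdeg x = (x i + x j + \sum_(l | (l != i) && (l != j)) x l)%N.
  by rewrite mdegE (bigD1 i) //= (bigD1 j) ?addnA // eq_sym.
rewrite !mdegij -addSn e; congr (_ + _)%N.
by apply: eq_bigr => l /andP[]; apply: ml.
Qed.

End Schubert.

(** * Feeding in the variables one at a time *)

Section MinimalTerm.
Variable n : nat.
Implicit Types (i j l : 'I_n) (w : 'S_n) (p f : {mpoly int[n]}).

Notation subst h f := (mmap (@mpolyC n int) h f).

Definition first_vars (k : nat) l : {mpoly int[n]} := if (l < k)%N then 'X_l else 0.

Definition shift_var (k : 'I_n) (j : nat) l : {mpoly int[n]} :=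
  if (l < k)%N then 'X_l else if l == j :> nat then 'X_k else 0.

(** The substitution sends x_i - x_j to x_k and turns the exchange of x_i and
    x_j into a move of x_k from position i to position j. *)
Lemma shift_var_ddiff (k i j : 'I_n) f : (k <= i)%N -> j = i.+1 :> nat ->
  subst (shift_var k i) (ddiff i j f) * 'X_k =
  subst (shift_var k i) f - subst (shift_var k j) f.
Proof.
move=> ki ji; have := congr1 (mmap (@mpolyC n int) (shift_var k i)) (ddiffE i j f).
rewrite rmorphM !rmorphB /= !mmapX !mmap1U mmap_msym.
have -> : shift_var k i i = 'X_k by rewrite /shift_var ltnNge ki eqxx.
have -> : shift_var k i j = 0.
  by rewrite /shift_var; case: ltnP => [|_]; [lia|case: eqP => //; lia].
rewrite subr0 mulrC => ->; congr (_ - _).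
apply: eq_mmap_msupp => m l _ _; rewrite /= /shift_var.
case: tpermP => [->|->|/eqP + /eqP +]; rewrite -?val_eqE /=.
- have -> : (j < k)%N = false by lia.
  have -> : (i < k)%N = false by lia.
  have -> : (j == i :> nat) = false by lia.
  by have -> : (i == j :> nat) = false by lia.
- have -> : (j < k)%N = false by lia.
  have -> : (i < k)%N = false by lia.
  by rewrite !eqxx.
by move=> /negbTE -> /negbTE ->.
Qed.

(** Since w s_i has no descent at i, its value does not change when x_k moves
    from i to j; so position j can be used in both summands. *)
Lemma shift_var_schubert (k i j : 'I_n) w : (k <= i)%N -> j = i.+1 :> nat ->
  subst (shift_var k i) (schubert w) =
  subst (shift_var k j) (schubert w) +
  if (w j < w i)%N
  then subst (shift_var k j) (schubert (swap_positions i j w)) * 'X_k else 0.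
Proof.
move=> ki ji; have := shift_var_ddiff (schubert w) ki ji.
rewrite schubert_ddiff // perm_length_lt //; case: ifP => wji; last first.
  by rewrite raddf0 mul0r => /esym/subr0_eq ->; rewrite addr0.
have := shift_var_ddiff (schubert (swap_positions i j w)) ki ji.
rewrite schubert_ddiff // perm_length_lt // !swap_positionsE tpermL tpermR.
rewrite ltnNge ltnW //= raddf0 mul0r => /esym/subr0_eq -> ->.
by rewrite addrC subrK.
Qed.

(** The entries that are still to meet x_k, at positions beyond j, may be k+1;
    the others are to be exhausted by x_0, ..., x_(k-1).  For j = n this is the
    bound for k variables, without x_k. *)
Definition ccode_bounded (k j : nat) w := [forall l : 'I_n, (ccode w l <= k + (j < l))%N].

Lemma ccode_bounded_swap (k : nat) i j w : j = i.+1 :> nat -> (w j < w i)%N ->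
  ccode_bounded k j (swap_positions i j w) = ccode_bounded k i w.
Proof.
move=> ji wji; apply/forallP/forallP => h l.
  rewrite (ccode_swap _ ji wji); have := h (tperm i j l).
  by case: tpermP => [->|->|/eqP + /eqP +]; rewrite -?val_eqE /=; lia.
have := h (tperm i j l); rewrite (ccode_swap _ ji wji) tpermK.
by case: tpermP => [->|->|/eqP + /eqP +]; rewrite -?val_eqE /=; lia.
Qed.

Lemma ccode_bounded_step (k : nat) i j w : j = i.+1 :> nat ->
  ccode_bounded k j w = ccode_bounded k i w && (ccode w j <= k)%N.
Proof.
move=> ji; apply/forallP/andP => [h|[/forallP h cj] l].
  split; last by have := h j; lia.
  by apply/forallP=> l; have := h l; lia.
by have := h l; have [->|] := eqVneq l j; rewrite -?val_eqE /=; lia.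
Qed.

(** Its value, 1, is obtained only at the end, in [schubert_const1E], by reading
    the minimal term of the Schubert polynomial of the longest permutation. *)
Definition schubert_const1 : int := (schubert (1%g : 'S_n))@_0%MM.

Definition lex_min_if_bounded (k j : nat) w p : Prop :=
  if ccode_bounded k j w then lex_min_term schubert_const1 (ccode_monomial w) p else p = 0.

Lemma lex_min_step (k i j : 'I_n) : (k <= i)%N -> j = i.+1 :> nat ->
  (forall w, lex_min_if_bounded k j w (subst (shift_var k j) (schubert w))) ->
  forall w, lex_min_if_bounded k i w (subst (shift_var k i) (schubert w)).
Proof.
move=> ki ji H w; rewrite (shift_var_schubert w ki ji).
have := H w; rewrite /lex_min_if_bounded (ccode_bounded_step k w ji).
case: (boolP (w j < w i)%N) => wji; last first.
  rewrite addr0; case: (boolP (ccode_bounded k i w)) => //= bw.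
  suff -> : (ccode w j <= k)%N by [].
  have := ccode_descent w ji; rewrite (negbTE wji) => /negbT; rewrite -leqNgt.
  by move: bw => /forallP /(_ i); rewrite ltnn addn0; lia.
have := H (swap_positions i j w); rewrite /lex_min_if_bounded ccode_bounded_swap //.
case: (boolP (ccode_bounded k i w)) => /= [bw Q|_ -> ->]; last by rewrite mul0r addr0.
have lt : (ccode (swap_positions i j w) i < n)%N by apply: leq_ltn_trans (ccode_leq _ _) _.
have cj : ccode w j = (Ordinal lt).+1.
  by rewrite (ccode_swap _ ji wji) tpermR eqxx addn1.
have -> : ccode_monomial w = (ccode_monomial (swap_positions i j w) + U_(Ordinal lt))%MM.
  exact: ccode_monomial_swap.
(* The entry o+1 = c_j to be lowered, with o = Ordinal lt, is either at most k,
   and then x_k is larger than x_o, or equal to k+1, and then x_k is x_o. *)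
rewrite cj; have {}Q := lex_min_term_mulX k Q; case: ltnP => [ok P|ko ->].
  by apply: lex_min_term_addr P Q _; rewrite !(addmC (ccode_monomial _)) mlex_lt_add2r mlex_lt_U.
rewrite add0r; have -> // : Ordinal lt = k.
apply: val_inj; have /forallP /(_ j) := bw; move: ko; rewrite cj /=; lia.
Qed.

(** Homogeneity of degree sum c_l kills the constant term of S_w unless the code
    is zero, and only the identity has the zero code. *)
Lemma lex_min_no_vars w : lex_min_if_bounded 0 n w (subst (first_vars 0) (schubert w)).
Proof.
rewrite (_ : subst _ _ = ((schubert w)@_0%MM)%:MP); last first.
  by rewrite -mmap_zero; apply: eq_mmap_msupp.
rewrite /lex_min_if_bounded; case: ifPn => [/forallP bw|].
  have cw l : ccode w l = 0%N by have := bw l; have := ltn_ord l; lia.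
  have -> : ccode_monomial w = 0%MM.
    by apply/mnmP=> i; rewrite ccode_monomialE mnmE big1 // => l _; rewrite cw.
  have -> : w = 1%g.
    apply: perm_ascents => i j ji; rewrite ltnNge leq_eqVlt.
    apply/negP=> /orP [/eqP/ord_inj/perm_inj/(congr1 val) /=|]; first by lia.
    by rewrite -(ccode_descent w ji) !cw.
  split=> [|a]; first by rewrite mcoeffC eqxx mulr1.
  by rewrite msuppC; case: ifP => //; rewrite inE => _ ->.
move=> /forallPn [l]; rewrite -ltnNge => cl; apply/eqP; rewrite mpolyC_eq0.
apply: contraTT cl; rewrite -mcoeff_msupp => /msupp_schubert_mdeg.
rewrite mdeg0 => /esym/eqP; rewrite mdeg_eq0 => /eqP e.
have n0 : (0 < n)%N by apply: leq_ltn_trans (ltn_ord l).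
have := congr1 (fun m : 'X_{1..n} => m (Ordinal n0)) e.
rewrite /= mnm0E ccode_monomialE => /eqP; rewrite sum_nat_eq0 => /forallP /(_ l) /=.
by lia.
Qed.

(** To introduce x_k, descend from the last position, where x_k is invisible, to
    position k, where the substitution is the one for k+1 variables. *)
Lemma lex_min_first_vars (k : nat) : (k <= n)%N ->
  forall w, lex_min_if_bounded k n w (subst (first_vars k) (schubert w)).
Proof.
elim: k => [_|k IH kn]; first exact: lex_min_no_vars.
have {}IH := IH (ltnW kn); pose K := Ordinal kn.
have last_step d i : n = (i + d).+1 -> (k <= i)%N ->
    forall w, lex_min_if_bounded k i w (subst (shift_var K i) (schubert w)).
  elim: d i => [|d IHd] i e ki.
    move=> w; have := IH w; rewrite /lex_min_if_bounded.
    have -> : ccode_bounded k n w = ccode_bounded k i w.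
      by apply: eq_forallb => l; have := ltn_ord l; lia.
    suff -> : subst (shift_var K i) (schubert w) = subst (first_vars k) (schubert w) by apply.
    apply: eq_mmap_msupp => m l mS ml0; have ml := msupp_schubert_staircase l mS.
    rewrite /shift_var /first_vars /=; case: ifP => // _.
    by case: eqP => //; lia.
  have hj : (i.+1 < n)%N by lia.
  by apply: (@lex_min_step K i (Ordinal hj)) => //; apply: IHd => /=; lia.
(* At position k the bound on the code is the one for k+1 variables, because
   c_l <= l makes the entries at positions up to k at most k anyway. *)
move=> w; have := last_step (n - k.+1)%N K; rewrite /= => /(_ ltac:(lia) (leqnn _) w).
rewrite /lex_min_if_bounded; have -> : ccode_bounded k k w = ccode_bounded k.+1 n w.
  apply: eq_forallb => l; have := ccode_leq w l; have := ltn_ord l; lia.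
suff -> : subst (shift_var K k) (schubert w) = subst (first_vars k.+1) (schubert w) by apply.
apply: eq_mmap_msupp => m l _ _; rewrite /shift_var /first_vars /= [(l < k.+1)%N]ltnS.
case: (ltngtP l k) => // e; congr 'X_[U_(_)%MM]; exact/esym/val_inj.
Qed.

Lemma lex_min_term_schubert w : lex_min_term schubert_const1 (ccode_monomial w) (schubert w).
Proof.
have := lex_min_first_vars (leqnn n) w.
have -> : subst (first_vars n) (schubert w) = schubert w.
  rewrite -[RHS]mmap_id; apply: eq_mmap_msupp => m l _ _.
  by rewrite /first_vars ltn_ord.
rewrite /lex_min_if_bounded; suff -> : ccode_bounded n n w by [].
apply/forallP=> l; have := ccode_leq w l; have := ltn_ord l; lia.
Qed.

Lemma schubert_const1E : schubert_const1 = 1.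
Proof.
have [<- _] := lex_min_term_schubert (longest_perm n).
by rewrite schubert_longestE mcoeffX eqxx.
Qed.

End MinimalTerm.

Theorem proposition4p8 (n : nat) (w : 'S_n) :
  let m := [multinom #|[set j : 'I_n | (i < ccode w j)%N]| | i < n] in
  lex_min_monomial m (schubert w) /\ (schubert w)@_m = 1.
Proof.
move=> m; have [] := lex_min_term_schubert w.
rewrite schubert_const1E -/m => wm wmin; split=> //; split=> //.
by rewrite mcoeff_msupp wm oner_eq0.
Qed.
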